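(* Let $u\in\{v,-v^{-1}\}$ and let $Q(u)$ be the $\mathcal H(B_3)$-module with ordered $\mathcal A$-basis $\kappa_0,\kappa_1,\kappa_2,\kappa_3$ described in the context. The bar operator on $Q(u)$ is given by \[ \overline{\kappa_0}=\kappa_0,\qquad \overline{\kappa_i}=\kappa_i-a\sum_{j=0}^{i-1}u^{\,j+1-i}\kappa_j\quad(1\le i\le 3). \] For $u=v$, the canonical basis is \[ C_i=\sum_{j=0}^iv^{\,j-i}\kappa_j\qquad(0\le i\le 3). \] For $u=-v^{-1}$, it is \[ C_0=\kappa_0,\qquad C_i=\kappa_i+v^{-1}\kappa_{i-1}\quad(1\le i\le 3). \]
   Context: $\mathcal A=\mathbb Z[v,v^{-1}]$, $a=v-v^{-1}$. $\mathcal H(B_3)$ is the $\mathcal A$-algebra generated by $T_0,T_1,T_2$ with $T_i^2=1+aT_i$, $T_0T_1T_0T_1=T_1T_0T_1T_0$, $T_1T_2T_1=T_2T_1T_2$, $T_0T_2=T_2T_0$; its bar involution is the ring involution with $\overline v=v^{-1}$, $\overline{T_i}=T_i^{-1}=T_i-a$. Note $u^2=1+au$ and $\overline u=u^{-1}$. $Q(u)$ is the free $\mathcal A$-module on $\kappa_0,\dots,\kappa_3$ with action $T_0\kappa_0=\kappa_1$, $T_0\kappa_1=\kappa_0+a\kappa_1$, $T_0\kappa_2=\kappa_3$, $T_0\kappa_3=\kappa_2+a\kappa_3$; $T_1\kappa_0=u\kappa_0$, $T_1\kappa_1=\kappa_2$, $T_1\kappa_2=\kappa_1+a\kappa_2$,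 $T_1\kappa_3=u\kappa_3$; $T_2\kappa_0=a\kappa_0-\kappa_1$, $T_2\kappa_1=-\kappa_0$, $T_2\kappa_2=u\kappa_2-a\kappa_0-au\kappa_1$, $T_2\kappa_3=u\kappa_3-au\kappa_0-au^2\kappa_1$. A bar operator on $Q(u)$ is an $\mathcal A$-antilinear involution $\psi$ with $\psi(hm)=\overline h\,\psi(m)$ for all $h\in\mathcal H(B_3)$; the bar operator meant here is the (unique) one fixing the generator $\kappa_0$, so the first assertion is that the displayed formulas define a bar operator. Relative to it and to the standard basis $\kappa_0<\kappa_1<\kappa_2<\kappa_3$, the canonical basis is the unique basis $\{C_i\}$ with $\overline{C_i}=C_i$ and $C_i\in\kappa_i+\sum_{j<i}v^{-1}\mathbb Z[v^{-1}]\kappa_j$. *)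

(* Defs.v *)
From HB Require Import structures.
From mathcomp Require Import all_boot all_order all_algebra generic_quotient.
From mathcomp Require Import boolp ring.

Set Implicit Arguments.
Unset Strict Implicit.
Unset Printing Implicit Defensive.

Import GRing.Theory.
Local Open Scope ring_scope.
Local Open Scope quotient_scope.

(** The ring [Z[v, v^-1]] is realised inside the field of fractions of [Z[v]],
    as the set of the fractions of the form [p / v^n]. *)

Local Notation Zv := {poly int}.
Local Notation "x %:F" := (@tofrac Zv x).

Definition is_laurent : {pred {fraction Zv}} :=
  fun x => `[< exists p n, x = p%:F / 'X%:F ^+ n >].

Lemma is_laurentP x :
  reflect (exists p n, x = p%:F / 'X%:F ^+ n) (x \in is_laurent).
Proof. exact: asboolP. Qed.

Lemma tofracX_neq0 n : ('X%:F : {fraction Zv}) ^+ n != 0.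
Proof. by rewrite expf_neq0 // tofrac_eq0 polyX_eq0. Qed.

Lemma is_laurent_subring : subring_closed is_laurent.
Proof.
split=> [|x y|x y].
- by apply/is_laurentP; exists 1, 0; rewrite rmorph1 expr0 divr1.
- move=> /is_laurentP[p [m ->]] /is_laurentP[q [n ->]].
  apply/is_laurentP; exists (p * 'X^n - q * 'X^m), (m + n)%N.
  rewrite rmorphB !rmorphM !rmorphXn /= mulrBl exprD invfM.
  congr (_ - _).
    by rewrite mulrACA divff ?mulr1 ?tofracX_neq0.
  by rewrite mulrA mulfK ?tofracX_neq0.
- move=> /is_laurentP[p [m ->]] /is_laurentP[q [n ->]].
  apply/is_laurentP; exists (p * q), (m + n)%N.
  by rewrite rmorphM /= exprD invfM mulrACA.
Qed.
HB.instance Definition _ := GRing.isSubringClosed.Build _ is_laurent is_laurent_subring.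

Record laurent := Laurent { laurent_val : {fraction Zv}; _ : laurent_val \in is_laurent }.
HB.instance Definition _ := [isSub for laurent_val].
HB.instance Definition _ := [Choice of laurent by <:].
HB.instance Definition _ := [SubChoice_isSubComNzRing of laurent by <:].

Definition laurent_unit : pred laurent :=
  fun x => (val x != 0) && ((val x)^-1 \in is_laurent).
Definition laurent_inv (x : laurent) : laurent :=
  if laurent_unit x then insubd x (val x)^-1 else x.

Lemma laurent_mulVx : {in laurent_unit, left_inverse 1 laurent_inv *%R}.
Proof.
move=> x ux; have /andP[x0 vx] : laurent_unit x := ux.
apply: val_inj; rewrite rmorphM rmorph1 /= /laurent_inv.
rewrite -topredE /= in ux; rewrite ux insubdK //.
by rewrite mulVf.
Qed.

Lemma laurent_unitPl (x y : laurent) : y * x = 1 -> laurent_unit x.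
Proof.
move=> /(congr1 val); rewrite rmorphM rmorph1 => yx1.
have x0 : val x != 0.
  by apply/eqP => /= x0; move/eqP: yx1; rewrite /= x0 mulr0 eq_sym oner_eq0.
rewrite /laurent_unit x0 /=.
have -> : (val x)^-1 = val y by apply: (mulIf x0); rewrite mulVf.
exact: valP.
Qed.

Lemma laurent_invx0id : {in [predC laurent_unit], laurent_inv =1 id}.
Proof. by move=> x; rewrite inE /laurent_inv => /negPf; rewrite -topredE /= => ->. Qed.

HB.instance Definition _ := GRing.ComNzRing_hasMulInverse.Build laurent
  laurent_mulVx laurent_unitPl laurent_invx0id.
HB.instance Definition _ :=
  [SubComUnitRing_isSubIntegralDomain of laurent by <:].

Lemma v_is_laurent : 'X%:F \in is_laurent.
Proof. by apply/is_laurentP; exists 'X, 0%N; rewrite expr0 divr1. Qed.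
Definition v : laurent := Laurent v_is_laurent.

Definition a : laurent := v - v^-1.

Lemma vU : v \is a GRing.unit.
Proof.
apply/unitrP; have vi : ('X%:F : {fraction Zv})^-1 \in is_laurent.
  by apply/is_laurentP; exists 1, 1%N; rewrite rmorph1 div1r expr1.
by exists (Laurent vi); split; apply: val_inj => /=; rewrite ?mulVf ?mulfV //;
  rewrite tofrac_eq0 polyX_eq0.
Qed.

Definition evalZ (p : Zv) (x : laurent) : laurent := (map_poly intr p).[x].

Lemma evalZM p q x : evalZ (p * q) x = evalZ p x * evalZ q x.
Proof. by rewrite /evalZ rmorphM hornerM. Qed.

Lemma evalZB p q x : evalZ (p - q) x = evalZ p x - evalZ q x.
Proof. by rewrite /evalZ rmorphB hornerD hornerN. Qed.

Lemma evalZX x : evalZ 'X x = x.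
Proof. by rewrite /evalZ map_polyX hornerX. Qed.

Lemma evalZXn n x : evalZ 'X^n x = x ^+ n.
Proof. by rewrite /evalZ map_polyXn hornerXn. Qed.

Lemma evalZ1 x : evalZ 1 x = 1.
Proof. by rewrite /evalZ rmorph1 hornerC. Qed.

Lemma evalZ_MXaddC p c x : evalZ (p * 'X + c%:P) x = evalZ p x * x + c%:~R.
Proof. by rewrite /evalZ rmorphD rmorphM /= map_polyX map_polyC /= hornerMXaddC. Qed.

Lemma val_evalZv p : val (evalZ p v) = p%:F.
Proof.
elim/poly_ind: p => [|p c IHp]; first by rewrite /evalZ rmorph0 horner0 !rmorph0.
rewrite evalZ_MXaddC rmorphD rmorphM rmorph_int /= [laurent_val _]IHp.
by rewrite rmorphD rmorphM /= -[c in c%:P]intz -[c%:~R%:P]/(polyC c%:~R) rmorph_int rmorph_int.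
Qed.

Lemma laurent_frac (x : laurent) :
  {pn : Zv * nat | val x = pn.1%:F / 'X%:F ^+ pn.2}.
Proof. by apply: cid; have /is_laurentP[p [n xE]] := valP x; exists (p, n). Qed.

Lemma laurent_eval (x : laurent) p n :
  val x = p%:F / 'X%:F ^+ n -> x = evalZ p v / v ^+ n.
Proof.
move=> xE; apply: (mulIr (unitrX n vU)); rewrite mulrVK ?unitrX ?vU //.
apply: val_inj; rewrite rmorphM rmorphXn /= val_evalZv xE.
by rewrite mulfVK ?tofracX_neq0.
Qed.

(** [p(v) / v^n] is sent to [p(v^-1) * v^n]; see [barE]. *)
Definition bar (x : laurent) : laurent :=
  let pn := sval (laurent_frac x) in evalZ pn.1 v^-1 * v ^+ pn.2.

Lemma barE x p n : val x = p%:F / 'X%:F ^+ n -> bar x = evalZ p v^-1 * v ^+ n.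
Proof.
rewrite /bar; case: laurent_frac => -[q m] /= -> e.
have {e} : q * 'X^n = p * 'X^m.
  apply/eqP; rewrite -tofrac_eq !rmorphM !rmorphXn /=.
  by move/eqP: e; rewrite eqr_div ?tofracX_neq0.
move=> /(congr1 (evalZ^~ v^-1)); rewrite !evalZM !evalZXn !exprVn => e.
have um k : v ^+ k \is a GRing.unit by rewrite unitrX ?vU.
by rewrite -(mulrVK (um n) (evalZ q _)) e mulrAC mulrVK.
Qed.

Lemma bar_zmod : zmod_morphism bar.
Proof.
move=> x y; case: (laurent_frac x) (laurent_frac y) => -[p m] /= xE [[q n] /= yE].
have xyE : val (x - y) = (p * 'X^n - q * 'X^m)%:F / 'X%:F ^+ (m + n).
  rewrite rmorphB /= xE yE rmorphB !rmorphM !rmorphXn /= mulrBl exprD invfM.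
  congr (_ - _); first by rewrite mulrACA divff ?mulr1 ?tofracX_neq0.
  by rewrite mulrA mulfK ?tofracX_neq0.
rewrite (barE xyE) (barE xE) (barE yE) evalZB !evalZM !evalZXn !exprVn.
have um k : v ^+ k \is a GRing.unit by rewrite unitrX ?vU.
rewrite exprD mulrBl; congr (_ - _).
  by rewrite [X in _ * X]mulrC mulrA mulrVK.
by rewrite mulrA mulrVK.
Qed.

Lemma bar_monoid : monoid_morphism bar.
Proof.
split=> [|x y].
  have /barE -> : val (1 : laurent) = 1%:F / 'X%:F ^+ 0.
    by rewrite !rmorph1 expr0 divr1.
  by rewrite evalZ1 mulr1.
case: (laurent_frac x) (laurent_frac y) => -[p m] /= xE [[q n] /= yE].
have xyE : val (x * y) = (p * q)%:F / 'X%:F ^+ (m + n).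
  by rewrite rmorphM /= xE yE rmorphM /= exprD invfM mulrACA.
by rewrite (barE xyE) (barE xE) (barE yE) evalZM exprD mulrACA.
Qed.

HB.instance Definition _ := GRing.isZmodMorphism.Build laurent laurent bar bar_zmod.
HB.instance Definition _ := GRing.isMonoidMorphism.Build laurent laurent bar bar_monoid.

Lemma bar_v : bar v = v^-1.
Proof.
have /barE -> : val v = 'X%:F / 'X%:F ^+ 0 by rewrite expr0 divr1.
by rewrite evalZX mulr1.
Qed.

Lemma barK : involutive bar.
Proof.
move=> x; case: (laurent_frac x) => -[p n] /= /[dup] /barE -> /laurent_eval ->.
rewrite rmorphM rmorphXn /= bar_v exprVn; congr (_ / _).
by rewrite /evalZ -horner_map /= -map_poly_comp (rmorphV _ vU) /= bar_v invrK;
   congr (_.[_]); apply: eq_map_poly => z /=; rewrite rmorph_int.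
Qed.

Lemma bar_a : bar a = - a.
Proof. by rewrite /a rmorphB rmorphV ?vU //= bar_v invrK opprB. Qed.

(** Membership in [v^-1 Z[v^-1]]. *)
Definition vinvZ (x : laurent) : Prop := exists p : Zv, x = v^-1 * evalZ p v^-1.

Variant gen := s0 | s1 | s2.

(** The Hecke algebra of type [B_3] is the quotient [hecke] of the formal
    expressions [hterm] by the least congruence [heq] which contains the axioms
    of [laurent]-algebras and the defining relations. Its universal property is
    given by [T_relations] and by the lemmas on [hlift]. *)
Inductive hterm :=
  | HConst of laurent
  | HGen of gen
  | HOpp of hterm
  | HAdd of hterm & hterm
  | HMul of hterm & hterm.

Local Notation "x +' y" := (HAdd x y) (at level 50, left associativity).
Local Notation "x *' y" := (HMul x y) (at level 40, left associativity).
Local Notation t0 := (HGen s0).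
Local Notation t1 := (HGen s1).
Local Notation t2 := (HGen s2).

Inductive heq : hterm -> hterm -> Prop :=
  | heq_refl x : heq x x
  | heq_sym x y : heq x y -> heq y x
  | heq_trans y x z : heq x y -> heq y z -> heq x z
  | heq_opp x x' : heq x x' -> heq (HOpp x) (HOpp x')
  | heq_add x x' y y' : heq x x' -> heq y y' -> heq (x +' y) (x' +' y')
  | heq_mul x x' y y' : heq x x' -> heq y y' -> heq (x *' y) (x' *' y')
  | heq_addA x y z : heq (x +' (y +' z)) (x +' y +' z)
  | heq_addC x y : heq (x +' y) (y +' x)
  | heq_add0 x : heq (HConst 0 +' x) x
  | heq_addN x : heq (HOpp x +' x) (HConst 0)
  | heq_mulA x y z : heq (x *' (y *' z)) (x *' y *' z)
  | heq_mul1 x : heq (HConst 1 *' x) x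
  | heq_mulDl x y z : heq ((x +' y) *' z) (x *' z +' y *' z)
  | heq_mulDr x y z : heq (x *' (y +' z)) (x *' y +' x *' z)
  | heq_constD c d : heq (HConst (c + d)) (HConst c +' HConst d)
  | heq_constM c d : heq (HConst (c * d)) (HConst c *' HConst d)
  | heq_constC c x : heq (HConst c *' x) (x *' HConst c)
  | heq_quadratic i : heq (HGen i *' HGen i) (HConst 1 +' HConst a *' HGen i)
  | heq_braid01 : heq (t0 *' t1 *' t0 *' t1) (t1 *' t0 *' t1 *' t0)
  | heq_braid12 : heq (t1 *' t2 *' t1) (t2 *' t1 *' t2)
  | heq_braid02 : heq (t0 *' t2) (t2 *' t0).

HB.instance Definition _ := gen_eqMixin hterm.
HB.instance Definition _ := gen_choiceMixin hterm.

Definition heqb (x y : hterm) : bool := `[< heq x y >].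

Lemma heqb_refl : reflexive heqb.
Proof. by move=> x; apply/asboolP; constructor. Qed.
Lemma heqb_sym : symmetric heqb.
Proof. by move=> x y; apply/asboolP/asboolP; apply: heq_sym. Qed.
Lemma heqb_trans : transitive heqb.
Proof. by move=> y x z /asboolP xy /asboolP yz; apply/asboolP; apply: heq_trans yz. Qed.

Canonical heq_equiv := EquivRel heqb heqb_refl heqb_sym heqb_trans.

Definition hecke := {eq_quot heq_equiv}.
HB.instance Definition _ := EqQuotient.on hecke.
HB.instance Definition _ := Choice.on hecke.

Lemma hpiP x y : heq x y <-> \pi_hecke x = \pi_hecke y.
Proof.
by split=> [xy|/eqmodP/asboolP //]; apply/eqmodP/asboolP.
Qed.

Lemma heq_repr x : heq (repr (\pi_hecke x)) x.
Proof. by apply/hpiP; rewrite reprK. Qed.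

Definition hconst (c : laurent) : hecke := \pi_hecke (HConst c).
Definition hopp (x : hecke) : hecke := locked (\pi_hecke (HOpp (repr x))).
Definition hadd (x y : hecke) : hecke := locked (\pi_hecke (repr x +' repr y)).
Definition hmul (x y : hecke) : hecke := locked (\pi_hecke (repr x *' repr y)).

Lemma pi_hopp x : \pi_hecke (HOpp x) = hopp (\pi x).
Proof. by rewrite /hopp -lock; apply/hpiP/heq_opp/heq_sym/heq_repr. Qed.
Lemma pi_hadd x y : \pi_hecke (x +' y) = hadd (\pi x) (\pi y).
Proof. by rewrite /hadd -lock; apply/hpiP/heq_add; apply/heq_sym/heq_repr. Qed.
Lemma pi_hmul x y : \pi_hecke (x *' y) = hmul (\pi x) (\pi y).
Proof. by rewrite /hmul -lock; apply/hpiP/heq_mul; apply/heq_sym/heq_repr. Qed.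

Lemma hecke_ind (P : hecke -> Prop) : (forall x, P (\pi_hecke x)) -> forall x, P x.
Proof. by move=> Px x; rewrite -[x]reprK. Qed.

Ltac heckeE :=
  repeat elim/hecke_ind => ?;
  rewrite /hconst -?(pi_hopp, pi_hadd, pi_hmul); apply/hpiP; by constructor.

Lemma haddA : associative hadd. Proof. move=> x y z; move: x y z; heckeE. Qed.
Lemma haddC : commutative hadd. Proof. move=> x y; move: x y; heckeE. Qed.
Lemma hadd0 : left_id (hconst 0) hadd. Proof. move=> x; move: x; heckeE. Qed.
Lemma haddN : left_inverse (hconst 0) hopp hadd.
Proof. move=> x; move: x; heckeE. Qed.
HB.instance Definition _ := GRing.isZmodule.Build hecke haddA haddC hadd0 haddN.

Lemma hmulA : associative hmul. Proof. move=> x y z; move: x y z; heckeE. Qed.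
Lemma hmul1 : left_id (hconst 1) hmul. Proof. move=> x; move: x; heckeE. Qed.
Lemma hconstC c x : hmul (hconst c) x = hmul x (hconst c).
Proof. move: x; heckeE. Qed.
Lemma hmulDl : left_distributive hmul hadd.
Proof. move=> x y z; move: x y z; heckeE. Qed.
Lemma hmulDr : right_distributive hmul hadd.
Proof. move=> x y z; move: x y z; heckeE. Qed.
Lemma hmul1r : right_id (hconst 1) hmul.
Proof. by move=> x; rewrite -hconstC hmul1. Qed.
Lemma hconstD c d : hconst (c + d) = hadd (hconst c) (hconst d).
Proof. heckeE. Qed.
Lemma hconstM c d : hconst (c * d) = hmul (hconst c) (hconst d).
Proof. by rewrite /hconst -pi_hmul; apply/hpiP/heq_constM. Qed.

Record hecke_relations (B : nzRingType) (q : B) (t : gen -> B) : Prop := {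
  hecke_quadratic : forall i, t i * t i = 1 + q * t i;
  hecke_braid01 : t s0 * t s1 * t s0 * t s1 = t s1 * t s0 * t s1 * t s0;
  hecke_braid12 : t s1 * t s2 * t s1 = t s2 * t s1 * t s2;
  hecke_braid02 : t s0 * t s2 = t s2 * t s0
}.

Section Evaluation.
Variables (B : nzRingType) (f : {rmorphism laurent -> B}) (t : gen -> B).

Fixpoint heval (x : hterm) : B :=
  match x with
  | HConst c => f c
  | HGen i => t i
  | HOpp x => - heval x
  | HAdd x y => heval x + heval y
  | HMul x y => heval x * heval y
  end.

Lemma heval_heq x y : (forall c b, f c * b = b * f c) ->
  hecke_relations (f a) t -> heq x y -> heval x = heval y.
Proof.
move=> fC [tq t01 t12 t02]; elim=> {x y} //=.
- by move=> y x z _ -> _ ->.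
- by move=> x x' _ ->.
- by move=> x x' y y' _ -> _ ->.
- by move=> x x' y y' _ -> _ ->.
- by move=> x y z; rewrite addrA.
- by move=> x y; rewrite addrC.
- by move=> x; rewrite rmorph0 add0r.
- by move=> x; rewrite rmorph0 addNr.
- by move=> x y z; rewrite mulrA.
- by move=> x; rewrite rmorph1 mul1r.
- by move=> x y z; rewrite mulrDl.
- by move=> x y z; rewrite mulrDr.
- by move=> c d; rewrite rmorphD.
- by move=> c d; rewrite rmorphM.
- by move=> i; rewrite rmorph1.
Qed.

End Evaluation.

Lemma character_relations : hecke_relations a (fun _ : gen => v).
Proof. by split=> // _; rewrite /a mulrBl mulVr ?vU // addrC subrK. Qed.

Lemma hecke1_neq0 : hconst 1 != hconst 0.
Proof.
apply/eqP => /hpiP /(heval_heq (f := idfun) (t := fun=> v)) /=.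
move=> /(_ (fun c b => mulrC c b) character_relations) /eqP.
by rewrite oner_eq0.
Qed.

HB.instance Definition _ := GRing.Zmodule_isNzRing.Build hecke
  hmulA hmul1 hmul1r hmulDl hmulDr hecke1_neq0.

Definition hscale (c : laurent) (x : hecke) : hecke := hconst c * x.

Lemma hscaleA c d x : hscale c (hscale d x) = hscale (c * d) x.
Proof. by rewrite /hscale mulrA -[hconst (c * d)]/(hconst (c * d)) hconstM. Qed.
Lemma hscale1 : left_id 1 hscale. Proof. exact: mul1r. Qed.
Lemma hscaleDr : right_distributive hscale +%R.
Proof. by move=> c x y; rewrite /hscale mulrDr. Qed.
Lemma hscaleDl x : {morph hscale^~ x : c d / c + d}.
Proof. by move=> c d; rewrite /hscale hconstD mulrDl. Qed.
HB.instance Definition _ := GRing.Zmodule_isLmodule.Build laurent hecke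
  hscaleA hscale1 hscaleDr hscaleDl.

Lemma hscaleAl (c : laurent) (x y : hecke) : c *: (x * y) = c *: x * y.
Proof. exact: mulrA. Qed.
HB.instance Definition _ := GRing.Lmodule_isLalgebra.Build laurent hecke hscaleAl.
Lemma hscaleAr (c : laurent) (x y : hecke) : c *: (x * y) = x * (c *: y).
Proof. by rewrite /GRing.scale /= /hscale !mulrA; congr (_ * _); apply: hconstC. Qed.
HB.instance Definition _ := GRing.Lalgebra_isAlgebra.Build laurent hecke hscaleAr.

Definition T (i : gen) : hecke := \pi_hecke (HGen i).

Lemma hconstE c : hconst c = c%:A.
Proof. by rewrite -[LHS]mulr1. Qed.

Lemma T_relations : hecke_relations (a%:A : hecke) T.
Proof.
rewrite -hconstE; split=> *; rewrite /T /GRing.mul /= /GRing.one /GRing.add /=;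
  rewrite /hconst -?(pi_hmul, pi_hadd); apply/hpiP; by constructor.
Qed.

Section Lift.
Variables (B : nzRingType) (f : {rmorphism laurent -> B}) (t : gen -> B).
Hypothesis fC : forall c b, f c * b = b * f c.
Hypothesis ft : hecke_relations (f a) t.

Definition hlift (x : hecke) : B := heval f t (repr x).

Lemma hlift_pi x : hlift (\pi x) = heval f t x.
Proof. exact: heval_heq fC ft (heq_repr x). Qed.

Lemma hlift_zmod : zmod_morphism hlift.
Proof.
elim/hecke_ind => x; elim/hecke_ind => y.
have -> : \pi_hecke x - \pi_hecke y = \pi_hecke (HAdd x (HOpp y)).
  by rewrite pi_hadd pi_hopp.
by rewrite !hlift_pi.
Qed.

Lemma hlift_monoid : monoid_morphism hlift.
Proof.
split; first by rewrite hlift_pi /= rmorph1.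
elim/hecke_ind => x; elim/hecke_ind => y.
have -> : \pi_hecke x * \pi_hecke y = \pi_hecke (HMul x y) by rewrite pi_hmul.
by rewrite !hlift_pi.
Qed.

Lemma hlift_const c : hlift c%:A = f c.
Proof. by rewrite -hconstE hlift_pi. Qed.

Lemma hlift_T i : hlift (T i) = t i.
Proof. by rewrite hlift_pi. Qed.

End Lift.

Lemma mulTV i : T i * (T i - a%:A) = 1.
Proof.
by rewrite mulrBr (hecke_quadratic T_relations) mulr_algl mulr_algr addrK.
Qed.

Lemma mulVT i : (T i - a%:A) * T i = 1.
Proof. by rewrite mulrBl (hecke_quadratic T_relations) addrK. Qed.

Lemma mulTVK i : cancel ( *%R (T i - a%:A)) ( *%R (T i)).
Proof. by move=> x; rewrite mulrA mulTV mul1r. Qed.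

Lemma mulVTK i : cancel ( *%R (T i)) ( *%R (T i - a%:A)).
Proof. by move=> x; rewrite mulrA mulVT mul1r. Qed.

Lemma barT_relations :
  hecke_relations (in_alg hecke (bar a)) (fun i => T i - a%:A).
Proof.
have linv (x y z : hecke) : x * y = 1 -> y * z = 1 -> x = z.
  by move=> xy yz; rewrite -[x]mulr1 -yz mulrA xy mul1r.
have [_ e01 e12 e02] := T_relations.
split=> [i|||].
- rewrite bar_a /= scaleNr mulNr [LHS]mulrBr mulVT; congr (_ - _).
  by rewrite mulr_algl mulr_algr.
- apply: (linv _ (T s1 * T s0 * T s1 * T s0)).
    by rewrite -!mulrA !mulVTK mulVT.
  by rewrite -e01 -!mulrA !mulTVK mulTV.
- apply: (linv _ (T s1 * T s2 * T s1)); last by rewrite e12 -!mulrA !mulTVK mulTV.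
  by rewrite -!mulrA !mulVTK mulVT.
- apply: (linv _ (T s2 * T s0)); last by rewrite -e02 -!mulrA !mulTVK mulTV.
  by rewrite -!mulrA !mulVTK mulVT.
Qed.

(** The bar involution of the Hecke algebra: the ring morphism which is [bar] on
    scalars and sends [T i] to [T i - a]. *)
Definition barH : hecke -> hecke :=
  hlift (in_alg hecke \o bar) (fun i => T i - a%:A).

Lemma barH_central (c : laurent) (b : hecke) :
  (in_alg hecke \o bar) c * b = b * (in_alg hecke \o bar) c.
Proof. by rewrite /= mulr_algl mulr_algr. Qed.

HB.instance Definition _ := GRing.isZmodMorphism.Build hecke hecke barH
  (hlift_zmod barH_central barT_relations).
HB.instance Definition _ := GRing.isMonoidMorphism.Build hecke hecke barH
  (hlift_monoid barH_central barT_relations).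

Lemma barH_const c : barH c%:A = (bar c)%:A.
Proof. exact: (hlift_const barH_central barT_relations). Qed.

Lemma barH_T i : barH (T i) = T i - a%:A.
Proof. exact: (hlift_T barH_central barT_relations). Qed.

Lemma barHK : involutive barH.
Proof.
elim/hecke_ind; elim=> [c|i|x IHx|x IHx y IHy|x IHx y IHy].
- by rewrite -/(hconst c) hconstE !barH_const barK.
- by rewrite -/(T i) barH_T rmorphB /= barH_T barH_const bar_a scaleNr opprK subrK.
- by rewrite pi_hopp -[hopp _]/(- (\pi_hecke x)) !rmorphN /= IHx.
- by rewrite pi_hadd -[hadd _ _]/(\pi_hecke x + \pi_hecke y) !rmorphD /= IHx IHy.
- by rewrite pi_hmul -[hmul _ _]/(\pi_hecke x * \pi_hecke y) !rmorphM /= IHx IHy.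
Qed.

Section ModuleRelations.
Variables (A : comNzRingType) (a u : A) (M0 M1 M2 : 'M[A]_4).
Variables (k0 k1 k2 k3 : 'cV[A]_4).
Hypothesis uu : u * u = 1 + a * u.
Hypotheses (E00 : M0 *m k0 = k1) (E01 : M0 *m k1 = k0 + a *: k1).
Hypotheses (E02 : M0 *m k2 = k3) (E03 : M0 *m k3 = k2 + a *: k3).
Hypotheses (E10 : M1 *m k0 = u *: k0) (E11 : M1 *m k1 = k2).
Hypotheses (E12 : M1 *m k2 = k1 + a *: k2) (E13 : M1 *m k3 = u *: k3).
Hypotheses (E20 : M2 *m k0 = a *: k0 - k1) (E21 : M2 *m k1 = - k0).
Hypothesis E22 : M2 *m k2 = u *: k2 - a *: k0 - (a * u) *: k1.
Hypothesis E23 : M2 *m k3 = u *: k3 - (a * u) *: k0 - (a * u ^+ 2) *: k1.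

Let ME := (E00, E01, E02, E03, E10, E11, E12, E13, E20, E21, E22, E23).
Let agree (A1 A2 : 'M[A]_4) := forall k, k \in [:: k0; k1; k2; k3] -> A1 *m k = A2 *m k.

Ltac column :=
  move=> k; rewrite !inE => /or4P[] /eqP ->;
  rewrite -?mulmxA ?mulmxDl ?mul1mx -?mulmxA ?mul_scalar_mx;
  do ?rewrite ME ?mulmxDr ?mulmxN -?scalemxAr;
  apply/colP => r; rewrite !mxE; ring: uu.

Lemma quadratic0 : agree (M0 *m M0) (1%:M + a%:M *m M0).
Proof. column. Qed.
Lemma quadratic1 : agree (M1 *m M1) (1%:M + a%:M *m M1).
Proof. column. Qed.
Lemma quadratic2 : agree (M2 *m M2) (1%:M + a%:M *m M2).
Proof. column. Qed.
Lemma braid01 : agree (M0 *m M1 *m M0 *m M1) (M1 *m M0 *m M1 *m M0).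
Proof. column. Qed.
Lemma braid12 : agree (M1 *m M2 *m M1) (M2 *m M1 *m M2).
Proof. column. Qed.
Lemma braid02 : agree (M0 *m M2) (M2 *m M0).
Proof. column. Qed.

End ModuleRelations.

Record uparam := UParam {
  uval :> laurent;
  _ : uval = v \/ uval = - v^-1
}.

Lemma uparam_unit (u : uparam) : (u : laurent) \is a GRing.unit.
Proof. by case: u => u [] /= ->; rewrite ?unitrN ?unitrV vU. Qed.

Lemma uparam_quadratic (u : uparam) : (u : laurent) * u = 1 + a * u.
Proof.
case: u => u uE; suff aE : a = u - u^-1.
  by rewrite /= aE mulrBl mulVr ?(uparam_unit (UParam uE)) // addrC subrK.
by case: uE => ->; rewrite /a // invrN invrK opprK addrC.
Qed.

Lemma bar_uparam (u : uparam) : bar u = (u : laurent)^-1.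
Proof.
by case: u => u [] /= ->; rewrite ?rmorphN ?rmorphV ?vU //= bar_v ?invrN.
Qed.

Definition Q (u : uparam) : Type := 'cV[laurent]_4.
HB.instance Definition _ u := GRing.Lmodule.on (Q u).

(** [kappa i] is a basis vector for [i < 4] only; it is [0] for [i >= 4]. *)
Definition kappa (u : uparam) (i : nat) : Q u := \col_(j < 4) (j == i :> nat)%:R.
Arguments kappa {u} i.

(** [T i] applied to [kappa j], for [j < 4]. *)
Definition Tkappa (u : uparam) (i : gen) (j : nat) : Q u :=
  match i, j with
  | s0, 0%N => kappa 1
  | s0, 1%N => kappa 0 + a *: kappa 1
  | s0, 2%N => kappa 3
  | s0, _ => kappa 2 + a *: kappa 3
  | s1, 0%N => uval u *: kappa 0
  | s1, 1%N => kappa 2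
  | s1, 2%N => kappa 1 + a *: kappa 2
  | s1, _ => uval u *: kappa 3
  | s2, 0%N => a *: kappa 0 - kappa 1
  | s2, 1%N => - kappa 0
  | s2, 2%N => uval u *: kappa 2 - a *: kappa 0 - (a * uval u) *: kappa 1
  | s2, _ => uval u *: kappa 3 - (a * uval u) *: kappa 0 - (a * uval u ^+ 2) *: kappa 1
  end.

Definition Tmx (u : uparam) (i : gen) : 'M[laurent]_4 :=
  \matrix_(k, j) Tkappa u i j k 0.

Lemma mulmx_kappa (u : uparam) (A : 'M[laurent]_4) (j k : 'I_4) :
  (A *m (kappa j : Q u)) k 0 = A k j.
Proof.
rewrite mxE (bigD1 j) //= !mxE eqxx mulr1 big1 ?addr0 // => l lj.
by rewrite !mxE (negPf lj : (l == j :> nat) = false) mulr0.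
Qed.

Lemma Tmx_kappa (u : uparam) i (j : nat) :
  (j < 4)%N -> Tmx u i *m (kappa j : Q u) = Tkappa u i j.
Proof.
by move=> j4; apply/colP => k; rewrite (mulmx_kappa u _ (Ordinal j4)) mxE.
Qed.

Lemma mx_kappaP (u : uparam) (A B : 'M[laurent]_4) :
  (forall j, (j < 4)%N -> A *m (kappa j : Q u) = B *m (kappa j : Q u)) -> A = B.
Proof.
move=> AB; apply/matrixP => k j.
by rewrite -(mulmx_kappa u A) AB // mulmx_kappa.
Qed.

Lemma Tmx_relations (u : uparam) :
  hecke_relations (a%:M : 'M[laurent]_4) (Tmx u).
Proof.
have uu := uparam_quadratic u.
have K k i : (k < 4)%N -> Tmx u i *m (kappa k : Q u) = Tkappa u i k := @Tmx_kappa u i k.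
have agree (A B : 'M[laurent]_4) :
    (forall k : 'cV_4,
      k \in [:: kappa 0 : Q u; kappa 1 : Q u; kappa 2 : Q u; kappa 3 : Q u] ->
      A *m k = B *m k) -> A = B.
  move=> AB; apply: (@mx_kappaP u) => j j4; apply: AB; rewrite !inE.
  by case: j j4 => [|[|[|[|//]]]] _; rewrite eqxx ?orbT.
split=> [[]|||]; apply: agree.
- exact: quadratic0 uu (K 0%N s0 isT) (K 1%N s0 isT) (K 2%N s0 isT) (K 3%N s0 isT).
- exact: quadratic1 uu (K 0%N s1 isT) (K 1%N s1 isT) (K 2%N s1 isT) (K 3%N s1 isT).
- exact: quadratic2 uu (K 0%N s2 isT) (K 1%N s2 isT) (K 2%N s2 isT) (K 3%N s2 isT).
- exact: braid01 uu (K 0%N s0 isT) (K 1%N s0 isT) (K 2%N s0 isT) (K 3%N s0 isT) (K 0%N s1 isT) (K 1%N s1 isT) (K 2%N s1 isT) (K 3%N s1 isT).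
- exact: braid12 uu (K 0%N s1 isT) (K 1%N s1 isT) (K 2%N s1 isT) (K 3%N s1 isT) (K 0%N s2 isT) (K 1%N s2 isT) (K 2%N s2 isT) (K 3%N s2 isT).
- exact: braid02 uu (K 0%N s0 isT) (K 1%N s0 isT) (K 2%N s0 isT) (K 3%N s0 isT) (K 0%N s2 isT) (K 1%N s2 isT) (K 2%N s2 isT) (K 3%N s2 isT).
Qed.

Definition Qrep (u : uparam) : hecke -> 'M[laurent]_4 :=
  hlift (@scalar_mx laurent 4) (Tmx u).

Section Action.
Variable u : uparam.

Lemma scalar_central (c : laurent) (b : 'M[laurent]_4) : c%:M * b = b * c%:M.
Proof. exact/esym/scalar_mxC. Qed.

HB.instance Definition _ := GRing.isZmodMorphism.Build hecke 'M[laurent]_4 (Qrep u)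
  (hlift_zmod scalar_central (Tmx_relations u)).
HB.instance Definition _ := GRing.isMonoidMorphism.Build hecke 'M[laurent]_4 (Qrep u)
  (hlift_monoid scalar_central (Tmx_relations u)).

Lemma Qrep_const c : Qrep u c%:A = c%:M.
Proof. exact: (hlift_const scalar_central (Tmx_relations u)). Qed.

Lemma Qrep_T i : Qrep u (T i) = Tmx u i.
Proof. exact: (hlift_T scalar_central (Tmx_relations u)). Qed.

Definition hact (h : hecke) (m : Q u) : Q u := Qrep u h *m m.

Lemma hact1 m : hact 1 m = m.
Proof. by rewrite /hact rmorph1 mul1mx. Qed.

Lemma hactA g h m : hact g (hact h m) = hact (g * h) m.
Proof. by rewrite /hact rmorphM mulmxA. Qed.

Lemma hactDl g h m : hact (g + h) m = hact g m + hact h m.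
Proof. by rewrite /hact rmorphD mulmxDl. Qed.

Lemma hactDr h m n : hact h (m + n) = hact h m + hact h n.
Proof. exact: mulmxDr. Qed.

Lemma hact_scalar c m : hact c%:A m = c *: m.
Proof. by rewrite /hact Qrep_const mul_scalar_mx. Qed.

Lemma hact_T_kappa i j : (j < 4)%N -> hact (T i) (kappa j) = Tkappa u i j.
Proof. by move=> j4; rewrite /hact Qrep_T Tmx_kappa. Qed.

Record bar_operator (psi : Q u -> Q u) : Prop := {
  bar_operatorD : forall m n, psi (m + n) = psi m + psi n;
  bar_operatorZ : forall c m, psi (c *: m) = bar c *: psi m;
  bar_operatorK : involutive psi;
  bar_operator_act : forall h m, psi (hact h m) = hact (barH h) (psi m)
}.

Record canonical_basis (psi : Q u -> Q u) (C : 'I_4 -> Q u) : Prop := {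
  canonical_basis_free : forall m : Q u,
    exists! c : {ffun 'I_4 -> laurent}, m = \sum_i c i *: C i;
  canonical_basis_bar : forall i, psi (C i) = C i;
  canonical_basis_triangular : forall i : 'I_4, exists c : 'I_i -> laurent,
    (forall j, vinvZ (c j)) /\ C i = kappa i + \sum_(j < i) c j *: kappa j
}.

End Action.

(* Main.v *)
(** The formulas define an antilinear map [qbar], unitriangular in the standard
    basis. Since [m |-> qbar (h m)] and [m |-> barH h (qbar m)] are both
    antilinear, compatibility need only be checked for [h = T i] on the [kappa j].
    The [kappa j] are reached from [kappa 0] by the [T i], so a bar operator is
    determined by its value on [kappa 0]. For canonical bases, the top nonzero
    coordinate of a [qbar]-fixed vector is [bar]-fixed, and [0] is the only
    [bar]-fixed element of [v^-1 Z[v^-1]]. *)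

Require Import Defs.
From mathcomp Require Import all_boot all_order all_algebra.
From mathcomp Require Import generic_quotient boolp ring zify.

Import GRing.Theory.
Local Open Scope ring_scope.
Local Open Scope quotient_scope.

(** * Laurent polynomials in [v^-1] and the bar involution *)

Lemma evalZv_inj : injective (evalZ^~ v).
Proof.
by move=> p q /(congr1 val); rewrite !val_evalZv => /eqP; rewrite tofrac_eq => /eqP.
Qed.

Lemma evalZD p q x : evalZ (p + q) x = evalZ p x + evalZ q x.
Proof. by rewrite /evalZ rmorphD hornerD. Qed.

Lemma evalZC c x : evalZ c%:P x = c%:~R.
Proof. by rewrite /evalZ map_polyC hornerC. Qed.

Lemma vinvZ0 : vinvZ 0.
Proof. by exists 0; rewrite /evalZ rmorph0 horner0 mulr0. Qed.

Lemma vinvZB x y : vinvZ x -> vinvZ y -> vinvZ (x - y).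
Proof. by move=> [p ->] [q ->]; exists (p - q); rewrite evalZB mulrBr. Qed.

Lemma vinvZ_exp n : vinvZ (v^-1 ^+ n.+1).
Proof. by exists 'X^n; rewrite evalZXn exprS. Qed.

Lemma bar_evalZ p x : bar (evalZ p x) = evalZ p (bar x).
Proof.
rewrite /evalZ -horner_map /= -map_poly_comp; congr (_.[_]).
by apply: eq_map_poly => z /=; rewrite rmorph_int.
Qed.

(** The witness [q] is the reversed polynomial [X^n p(1/X)]: each Horner step adds the new constant
    term [c] as the top coefficient. *)
Lemma evalZ_reverse (p : {poly int}) n : (size p <= n)%N ->
  exists2 q : {poly int}, evalZ p v^-1 * v ^+ n = evalZ q v & (size q <= n.+1)%N.
Proof.
elim/poly_ind: p n => [|p c IHp] n sp.
  by exists 0; rewrite ?size_poly0 // /evalZ !rmorph0 !horner0 mul0r.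
have [p0|p0] := eqVneq p 0.
  exists (c *: 'X^n); last by rewrite (leq_trans (size_scale_leq _ _)) ?size_polyXn.
  by rewrite p0 mul0r add0r -mul_polyC evalZM evalZXn !evalZC.
case: n sp => [|n]; rewrite size_MXaddC (negPf p0) //= ltnS => /IHp[q qE sq].
exists (q + c *: 'X^(n.+1)).
  rewrite evalZ_MXaddC evalZD -mul_polyC evalZM evalZXn evalZC -qE mulrDl.
  by congr (_ + _); rewrite exprS mulrA mulrVK ?vU.
rewrite (leq_trans (size_polyD _ _)) // geq_max (leq_trans sq) //=.
by rewrite (leq_trans (size_scale_leq _ _)) ?size_polyXn.
Qed.

(* From [v p(v) = v^-1 p(v^-1)], multiplying by [v^(n+1)] with [n] the size of
   [p] gives a polynomial of size [n + size p + 2] on the left and at most [n + 1]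
   on the right. *)
Lemma vinvZ_bar_fixed x : vinvZ x -> bar x = x -> x = 0.
Proof.
move=> [p ->]; rewrite rmorphM /= bar_evalZ rmorphV ?vU //= bar_v invrK => e.
have [q qE sq] := evalZ_reverse _ _ (leqnn (size p)).
suff -> : p = 0 by rewrite /evalZ rmorph0 horner0 mulr0.
have /evalZv_inj pq : evalZ (p * 'X^((size p).+2)) v = evalZ q v.
  rewrite -qE evalZM evalZXn !exprS mulrA [_ * v]mulrC e mulrA.
  by rewrite [v^-1 * _ * v]mulrAC mulVr ?vU // mul1r.
apply/eqP/negPn/negP => p0; move: sq; rewrite -pq size_Mmonic ?monicXn //.
by rewrite size_polyXn; lia.
Qed.

(** * The antilinear map [qbar] and its involutivity *)

Section BarOperator.
Variable u : uparam.
Local Notation Q := (Q u).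
Local Notation kappa := (@kappa u).

(** This treats both values of [u] at once: the coordinate identities become polynomial identities
    in [u] and [u^-1]. *)
Lemma aE : a = uval u - (uval u)^-1.
Proof. by case: u => x [] /= ->; rewrite /a // invrN invrK opprK addrC. Qed.

Lemma kappaE i (k : 'I_4) : kappa i k 0 = (k == i :> nat)%:R.
Proof. by rewrite mxE. Qed.

Lemma kappa_sum (m : Q) : m = \sum_(j < 4) m j 0 *: kappa j.
Proof.
apply/colP => k; rewrite summxE (bigD1 k) //= big1 => [|j jk].
  by rewrite mxE kappaE eqxx mulr1 addr0.
by rewrite mxE kappaE eq_sym (negPf jk : (j == k :> nat) = false) mulr0.
Qed.

Definition kbar (i : nat) : Q :=
  kappa i - a *: \sum_(0 <= j < i) uval u ^ (j%:Z + 1 - i%:Z) *: kappa j.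

(** The antilinear extension of [kappa j |-> kbar j]. *)
Definition qbar (m : Q) : Q := \sum_(j < 4) bar (m j 0) *: kbar j.

Lemma qbarD m n : qbar (m + n) = qbar m + qbar n.
Proof.
by rewrite -big_split; apply: eq_bigr => j _ /=; rewrite mxE rmorphD scalerDl.
Qed.

Lemma qbarZ c m : qbar (c *: m) = bar c *: qbar m.
Proof.
by rewrite scaler_sumr; apply: eq_bigr => j _; rewrite mxE rmorphM scalerA.
Qed.

Lemma qbarN m : qbar (- m) = - qbar m.
Proof. by rewrite -scaleN1r qbarZ rmorphN rmorph1 scaleN1r. Qed.

Lemma qbar_sum I (r : seq I) (P : pred I) (F : I -> Q) :
  qbar (\sum_(i <- r | P i) F i) = \sum_(i <- r | P i) qbar (F i).
Proof.
apply: (big_morph _ qbarD).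
by rewrite -[0 in LHS](scale0r 0) qbarZ rmorph0 scale0r.
Qed.

Lemma qbar_kappa i : (i < 4)%N -> qbar (kappa i) = kbar i.
Proof.
move=> i4; rewrite /qbar (bigD1 (Ordinal i4)) //= big1 => [|j ji].
  by rewrite kappaE eqxx rmorph1 scale1r addr0.
by rewrite kappaE (negPf ji : (j == i :> nat) = false) rmorph0 scale0r.
Qed.

Lemma kbar_coord i (k : 'I_4) : (i <= k)%N -> kbar i k 0 = (k == i :> nat)%:R.
Proof.
move=> ik; rewrite /kbar !mxE summxE big_nat big1 ?mulr0 ?subr0 // => j /andP[_ ji].
by rewrite !mxE gtn_eqF ?mulr0 // (leq_trans ji).
Qed.

Lemma expr_shift (x : laurent) (i j : nat) : (j <= i)%N ->
  x ^ (j%:Z - i%:Z) = x^-1 ^+ (i - j).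
Proof.
move=> ji; rewrite (_ : j%:Z - i%:Z = - (i - j)%N%:Z); last by lia.
by rewrite -exprnN exprVn.
Qed.

Lemma kbarE_exp i :
  kbar i = kappa i - a *: \sum_(0 <= j < i) (uval u)^-1 ^+ (i - j.+1) *: kappa j.
Proof.
congr (_ - _ *: _); rewrite !big_nat; apply: eq_bigr => j /andP[_ ji].
by rewrite -expr_shift // (_ : j%:Z + 1 = j.+1%:Z) // -addn1 PoszD.
Qed.

Lemma kbar0 : kbar 0 = kappa 0.
Proof. by rewrite kbarE_exp big_nil scaler0 subr0. Qed.

Lemma kbar1 : kbar 1 = kappa 1 - a *: kappa 0.
Proof. by rewrite kbarE_exp big_nat1 expr0 scale1r. Qed.

Lemma kbar2 : kbar 2 = kappa 2 - a *: ((uval u)^-1 *: kappa 0 + kappa 1).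
Proof.
rewrite kbarE_exp big_mkord !big_ord_recr big_ord0 /= add0r.
by rewrite !subSS ?subn0 expr0 ?expr1 scale1r.
Qed.

Lemma kbar3 : kbar 3 =
  kappa 3 - a *: ((uval u)^-1 ^+ 2 *: kappa 0 + (uval u)^-1 *: kappa 1 + kappa 2).
Proof.
rewrite kbarE_exp big_mkord !big_ord_recr big_ord0 /= add0r.
by rewrite !subSS ?subn0 expr0 ?expr1 scale1r.
Qed.

Definition kbarE := (kbar0, kbar1, kbar2, kbar3).

Lemma mulrVu : uval u * (uval u)^-1 = 1.
Proof. by rewrite mulrV // uparam_unit. Qed.

(* The basis vectors are generalized so that [mxE] does not unfold them. *)
Ltac coordinates :=
  rewrite ?aE; move: (kappa 0) (kappa 1) (kappa 2) (kappa 3) mulrVu;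
  move: (uval u) (uval u)^-1 => w w' k0 k1 k2 k3 ww';
  apply/colP => r; rewrite ?mxE;
  match goal with ww : _ * _ = 1 |- _ => ring: ww end.

Lemma qbarK : involutive qbar.
Proof.
(* The square of an antilinear map is linear, so the standard basis suffices. *)
have K j : (j < 4)%N -> qbar (kbar j) = kappa j.
  case: j => [|[|[|[|//]]]] _; rewrite ?kbarE;
    rewrite ?(qbarD, qbarN, qbarZ, qbar_kappa) // ?bar_a ?rmorphXn /=;
    rewrite ?(rmorphV _ (uparam_unit u)) /= ?bar_uparam ?invrK ?kbarE;
    coordinates.
move=> m; rewrite [qbar m]/qbar qbar_sum [RHS]kappa_sum.
by apply: eq_bigr => j _; rewrite qbarZ barK K.
Qed.

(** * Compatibility of [qbar] with the Hecke action *)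

Lemma hactZ h c (m : Q) : hact h (c *: m) = c *: hact h m.
Proof. exact/esym/scalemxAr. Qed.

Lemma hactN h (m : Q) : hact h (- m) = - hact h m.
Proof. by rewrite -scaleN1r hactZ scaleN1r. Qed.

Lemma hact_sum h I (r : seq I) (P : pred I) (F : I -> Q) :
  hact h (\sum_(i <- r | P i) F i) = \sum_(i <- r | P i) hact h (F i).
Proof. exact: mulmx_sumr. Qed.

Lemma qbar_T_kappa i j : (j < 4)%N ->
  qbar (Tkappa u i j) = hact (T i - a%:A) (kbar j).
Proof.
rewrite -scaleNr hactDl hact_scalar.
case: i j => [] [|[|[|[|//]]]] _; rewrite ?kbarE;
  rewrite ?(hactDr, hactN, hactZ) ?hact_T_kappa // /Tkappa;
  rewrite ?(qbarD, qbarN, qbarZ, qbar_kappa) // ?(rmorphM, rmorphXn) /=;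
  rewrite ?bar_a ?bar_uparam ?kbarE; coordinates.
Qed.

(** Induction on a term representing [h]. The vector [m] stays general because the product case uses
    the hypothesis for [x] at [hact y m]. *)
Lemma qbar_act h m : qbar (hact h m) = hact (barH h) (qbar m).
Proof.
elim/hecke_ind: h m; elim=> [c|i|x IHx|x IHx y IHy|x IHx y IHy] m.
- by rewrite -/(hconst c) hconstE barH_const !hact_scalar qbarZ.
- rewrite -/(T i) barH_T [m]kappa_sum hact_sum !qbar_sum hact_sum.
  apply: eq_bigr => j _; rewrite hactZ !qbarZ hactZ qbar_kappa //.
  by rewrite hact_T_kappa // qbar_T_kappa.
- rewrite pi_hopp -[hopp _]/(- \pi_hecke x) !rmorphN /hact !rmorphN !mulNmx.
  by rewrite qbarN; congr (- _); apply: IHx.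
- rewrite pi_hadd -[hadd _ _]/(\pi_hecke x + \pi_hecke y) rmorphD !hactDl qbarD.
  by rewrite IHx IHy.
- rewrite pi_hmul -[hmul _ _]/(\pi_hecke x * \pi_hecke y) rmorphM -!hactA.
  by rewrite IHx IHy.
Qed.

Lemma qbar_operator : bar_operator qbar.
Proof. by split; [exact: qbarD|exact: qbarZ|exact: qbarK|exact: qbar_act]. Qed.

(** * Uniqueness of the bar operator *)

Lemma bar_operator_uniq (phi : Q -> Q) :
  bar_operator phi -> phi (kappa 0) = kappa 0 -> phi =1 qbar.
Proof.
move=> [phiD phiZ _ phiA] phi0.
have phi_act i m : phi m = qbar m -> phi (hact (T i) m) = qbar (hact (T i) m).
  by move=> e; rewrite phiA e qbar_act.
(* Agreement spreads along [kappa 1 = T0 kappa 0], [kappa 2 = T1 kappa 1],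
   [kappa 3 = T0 kappa 2]. *)
have e0 : phi (kappa 0) = qbar (kappa 0) by rewrite phi0 qbar_kappa ?kbar0.
have e1 : phi (kappa 1) = qbar (kappa 1).
  by have := phi_act s0 _ e0; rewrite hact_T_kappa.
have e2 : phi (kappa 2) = qbar (kappa 2).
  by have := phi_act s1 _ e1; rewrite hact_T_kappa.
have e3 : phi (kappa 3) = qbar (kappa 3).
  by have := phi_act s0 _ e2; rewrite hact_T_kappa.
have phi00 : phi 0 = 0.
  by rewrite -[0 in LHS](scale0r (0 : Q)) phiZ rmorph0 scale0r.
move=> m; rewrite [m]kappa_sum qbar_sum (big_morph phi phiD phi00).
apply: eq_bigr => j _; rewrite phiZ qbarZ; congr (_ *: _).
by case: j => [[|[|[|[|//]]]]].
Qed.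

(** * Uniqueness and freeness of canonical bases *)

Lemma qbar_fixed_eq0 (m : Q) :
  qbar m = m -> (forall k, vinvZ (m k 0)) -> m = 0.
Proof.
move=> mfix mv; apply/eqP/negPn/negP => m0.
have /existsP[i mi] : [exists i, m i 0 != 0].
  apply: contraNT m0; rewrite negb_exists => /forallP m0.
  by apply/eqP/colP => k; rewrite mxE; apply/eqP; rewrite -[_ == _]negbK m0.
case: (@arg_maxnP _ i (fun k => m k 0 != 0) val mi) => k mk kmax.
move/eqP: (mk); apply; apply: vinvZ_bar_fixed => //.
(* Only [j = k] contributes to coordinate [k] of [qbar m]: for [j < k] the vector [kbar j] has no
   [kappa k] term, and for [j > k] maximality of [k] gives [m j 0 = 0]. *)
rewrite -{2}mfix /qbar summxE (bigD1 k) //= big1 => [|j jk].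
  by rewrite mxE kbar_coord // eqxx mulr1 addr0.
rewrite mxE; have [jk'|kj] := leqP j k.
  by rewrite kbar_coord // eq_sym (negPf jk : (j == k :> nat) = false) mulr0.
have [->|/kmax] := eqVneq (m j 0) 0; first by rewrite rmorph0 mul0r.
by rewrite /= leqNgt kj.
Qed.

Definition unitriangular (C : 'I_4 -> Q) := forall i : 'I_4,
  exists c : 'I_i -> laurent,
    (forall j, vinvZ (c j)) /\ C i = kappa i + \sum_(j < i) c j *: kappa j.

Lemma unitriangular_ge (C : 'I_4 -> Q) (i k : 'I_4) : unitriangular C ->
  (i <= k)%N -> C i k 0 = (k == i)%:R.
Proof.
move=> /(_ i)[c [_ ->]] ik; rewrite mxE kappaE summxE big1 ?addr0 // => j _.
by rewrite mxE kappaE gtn_eqF ?mulr0 // (leq_trans _ ik).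
Qed.

Lemma unitriangular_lt (C : 'I_4 -> Q) (i k : 'I_4) : unitriangular C ->
  (k < i)%N -> vinvZ (C i k 0).
Proof.
move=> /(_ i)[c [cv ->]] ki; rewrite mxE kappaE ltn_eqF // add0r summxE.
rewrite (bigD1 (Ordinal ki)) //= big1 => [|j jk].
  by rewrite addr0 mxE kappaE eqxx mulr1; apply: cv.
by rewrite mxE kappaE eq_sym (negPf jk : (j == k :> nat) = false) mulr0.
Qed.

(** In [C i - C' i] the leading terms cancel, which leaves a [qbar]-fixed vector with all
    coordinates in [v^-1 Z[v^-1]]. *)
Lemma canonical_basis_uniq (C C' : 'I_4 -> Q) :
  canonical_basis qbar C -> canonical_basis qbar C' -> C = C'.
Proof.
move=> [_ Cb Ct] [_ Cb' Ct']; apply/funext => i; apply: subr0_eq.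
apply: qbar_fixed_eq0 => [|k]; first by rewrite qbarD qbarN Cb Cb'.
rewrite !mxE; have [ik|ki] := leqP i k.
  by rewrite !unitriangular_ge // subrr; apply: vinvZ0.
by apply: vinvZB; apply: unitriangular_lt.
Qed.

Lemma unitriangular_free (C : 'I_4 -> Q) (m : Q) : unitriangular C ->
  exists! c : {ffun 'I_4 -> laurent}, m = \sum_i c i *: C i.
Proof.
move=> Ct; pose M : 'M[laurent]_4 := \matrix_(k, i) C i k 0.
have ME (c : 'I_4 -> laurent) : \sum_i c i *: C i = M *m \col_i c i.
  apply/colP => k; rewrite summxE mxE; apply: eq_bigr => i _.
  by rewrite !mxE mulrC.
have Mu : M \in unitmx.
  (* [M] is upper unitriangular; [det_trig] concerns lower triangular matrices, hence the
     transpose. *)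
  rewrite -unitmx_tr unitmxE det_trig; last first.
    apply/is_trig_mxP => i j ij; rewrite !mxE unitriangular_ge // 1?ltnW //.
    by rewrite (gtn_eqF ij : (j == i) = false).
  by rewrite big1 ?unitr1 // => i _; rewrite !mxE unitriangular_ge ?eqxx.
exists [ffun i => (invmx M *m m) i 0]; split.
  rewrite ME -[LHS](mulKVmx Mu); congr (_ *m _).
  by apply/colP => i; rewrite [RHS]mxE ffunE.
move=> c ->; apply/ffunP => i.
by rewrite ffunE ME mulKmx // mxE.
Qed.

Lemma canonical_basis_unique (C : 'I_4 -> Q) :
  (forall i, qbar (C i) = C i) -> unitriangular C -> unique (canonical_basis qbar) C.
Proof.
move=> Cb Ct; suff CC : canonical_basis qbar C.
  by split=> // C'; apply: canonical_basis_uniq.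
by split=> // m; apply: unitriangular_free.
Qed.

(** * The explicit canonical bases for the two values of [u] *)

Lemma canonical_v : uval u = v ->
  unique (canonical_basis qbar)
    (fun i : 'I_4 => \sum_(0 <= j < i.+1) v ^ (j%:Z - i%:Z) *: kappa j).
Proof.
move=> uv; apply: canonical_basis_unique => i; last first.
  exists (fun j : 'I_i => v ^ (j%:Z - i%:Z)); split=> [j|].
    by rewrite expr_shift 1?ltnW // -[(i - j)%N]prednK ?subn_gt0 //; apply: vinvZ_exp.
  by rewrite big_nat_recr //= subrr expr0z scale1r addrC big_mkord.
(* With natural powers of [u^-1], whose bar is [u], invariance becomes a coordinate identity. *)
have -> : \sum_(0 <= j < i.+1) v ^ (j%:Z - i%:Z) *: kappa j =
          \sum_(0 <= j < i.+1) (uval u)^-1 ^+ (i - j) *: kappa j.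
  by rewrite !big_nat; apply: eq_bigr => j /andP[_ ji]; rewrite uv expr_shift.
case: i => [[|[|[|[|//]]]] i4] /=.
all: rewrite big_mkord !big_ord_recr big_ord0 /= add0r ?subSS ?subn0.
all: rewrite ?(qbarD, qbarZ, qbar_kappa) // ?rmorphXn /=.
all: rewrite ?(rmorphV _ (uparam_unit u)) /= ?bar_uparam ?invrK ?kbarE; coordinates.
Qed.

Lemma canonical_Nv : uval u = - v^-1 ->
  unique (canonical_basis qbar)
    (fun i : 'I_4 => if i == 0%N :> nat then kappa 0
                     else kappa i + v^-1 *: kappa i.-1).
Proof.
move=> uv; apply: canonical_basis_unique => i; last first.
  case: i => [[|i] i4] /=.
    by exists (fun=> 0); split=> [j|]; [apply: vinvZ0|rewrite big_ord0 addr0].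
  (* The index is now [i.+1], so [ord_max] is the position of [kappa i]. *)
  exists (fun j => if j == ord_max then v^-1 else 0); split=> [j|].
    by case: eqP => _; [apply: (vinvZ_exp 0)|apply: vinvZ0].
  rewrite (bigD1 ord_max) //= eqxx big1 ?addr0 // => j /negPf ->.
  by rewrite scale0r.
(* For [i >= 1] the vector is [kappa i - u kappa (i-1)]. It is fixed because
   [kbar i - u^-1 kbar (i-1)] telescopes to [kappa i - (a + u^-1) kappa (i-1)], and
   [a + u^-1 = u]. *)
have -> : v^-1 = - uval u by rewrite uv opprK.
case: i => [[|[|[|[|//]]]] i4] /=.
all: rewrite ?(qbarD, qbarZ, qbar_kappa) // ?rmorphN /= ?bar_uparam ?kbarE; coordinates.
Qed.

End BarOperator.

Theorem proposition7p9 (u : uparam) :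
  exists psi : Q u -> Q u,
  [/\ unique (fun phi : Q u -> Q u => bar_operator phi /\ phi (kappa 0) = kappa 0) psi,
      forall i : nat, (1 <= i <= 3)%N ->
        psi (kappa i) =
        kappa i - a *: \sum_(0 <= j < i) (u : laurent) ^ (j%:Z + 1 - i%:Z) *: kappa j,
      (u : laurent) = v ->
        unique (canonical_basis psi)
          (fun i : 'I_4 => \sum_(0 <= j < i.+1) v ^ (j%:Z - i%:Z) *: kappa j)
    & (u : laurent) = - v^-1 ->
        unique (canonical_basis psi)
          (fun i : 'I_4 => if i == 0%N :> nat then kappa 0
                           else kappa i + v^-1 *: kappa i.-1)].
Proof.
exists (qbar u); split.
- split; first by split; [exact: qbar_operator|rewrite qbar_kappa // kbar0].
  by move=> phi [phib phi0]; apply/funext => m; rewrite (bar_operator_uniq u phi).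
- by case=> [|[|[|[|//]]]] // _; rewrite qbar_kappa.
- exact: canonical_v.
- exact: canonical_Nv.
Qed.
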